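(* No measure for $\mathfrak{P}$ (the class of finite posets) valued in a field is regular.
   Context: All posets are finite; the empty poset is allowed. An embedding of posets is an injective map $\alpha\colon P\to Q$ with $x\le y\iff\alpha(x)\le\alpha(y)$. Given embeddings $\alpha\colon P\to Q$ and $\beta\colon P\to P'$, an amalgamation of $Q$ and $P'$ over $P$ is a triple $(Q',\alpha',\beta')$ where $Q'$ is a poset and $\alpha'\colon P'\to Q'$, $\beta'\colon Q\to Q'$ are embeddings with $\beta'\circ\alpha=\alpha'\circ\beta$ and $Q'=\mathrm{im}(\alpha')\cup\mathrm{im}(\beta')$; amalgamations are considered up to the evident notion of isomorphism. A measure for $\mathfrak{P}$ valued in a commutative ring $k$ is a rule $\nu$ assigning to each embedding $\alpha\colon P\to Q$ of finite posets a value $\nu(\alpha)\in k$ such that: (a) $\nu(\alpha)=1$ if $\alpha$ is an isomorphism; (b) $\nu(\beta\circ\alpha)=\nu(\beta)\nu(\alpha)$ when the composition is defined; (c) given embeddings $\alpha\colon P\to Q$ and $\beta\colon P\to P'$, with $(Q'_i,\alpha'_i,\beta'_i)$, $1\le i\le r$, the various amalgamations up to isomorphism, $\nu(\alpha)=\sum_{i=1}^r\nu(\alpha'_i)$. Put $\nu(P)=\nu(\emptyset\to P)$. A measure $\nu$ valued in a field is regular if $\nu(P)\ne0$ for every finite poset $P$. *)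

(* Defs.v *)
From HB Require Import structures.
From mathcomp Require Import all_boot all_order all_algebra.

Set Implicit Arguments.
Unset Strict Implicit.
Unset Printing Implicit Defensive.

Import Order.TTheory GRing.Theory.

Local Open Scope ring_scope.

(* Embeddings are finite functions satisfying a boolean predicate, so that two
   embeddings with the same values are equal. *)
Definition is_embedding d1 d2 (P : finPOrderType d1) (Q : finPOrderType d2)
    (f : {ffun P -> Q}) : bool :=
  injectiveb f && [forall x, forall y, (x <= y)%O == (f x <= f y)%O].

Record embedding d1 d2 (P : finPOrderType d1) (Q : finPOrderType d2) :=
  Embedding { emb_fun :> {ffun P -> Q}; emb_funP : is_embedding emb_fun }.

HB.instance Definition _ d1 d2 (P : finPOrderType d1) (Q : finPOrderType d2) :=
  [isSub for @emb_fun d1 d2 P Q].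

Lemma is_embeddingP d1 d2 (P : finPOrderType d1) (Q : finPOrderType d2)
    (f : {ffun P -> Q}) :
  reflect (injective f /\ forall x y, (x <= y)%O <-> (f x <= f y)%O)
          (is_embedding f).
Proof.
apply: (iffP andP) => -[/injectiveP f_inj f_le]; split=> //.
  by move=> x y; have /forallP/(_ x)/forallP/(_ y)/eqP -> := f_le.
by apply/forallP => x; apply/forallP => y; apply/eqP; apply/idP/idP => /f_le.
Qed.

Fact emb_comp_subproof d1 d2 d3 (P : finPOrderType d1) (Q : finPOrderType d2)
    (S : finPOrderType d3) (b : embedding Q S) (a : embedding P Q) :
  is_embedding [ffun x => b (a x)].
Proof.
have /is_embeddingP[a_inj a_le] := emb_funP a.
have /is_embeddingP[b_inj b_le] := emb_funP b.
apply/is_embeddingP; split=> [x y|x y]; rewrite !ffunE; first by move/b_inj/a_inj.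
by split=> [/a_le/b_le|/b_le/a_le].
Qed.

Definition emb_comp d1 d2 d3 (P : finPOrderType d1) (Q : finPOrderType d2)
    (S : finPOrderType d3) (b : embedding Q S) (a : embedding P Q) :
  embedding P S := Embedding (emb_comp_subproof b a).

Fact emb_empty_subproof d (P : finPOrderType d) :
  is_embedding [ffun i : 'I_0 => match notF (ltn_ord i) return P with end].
Proof. by apply/is_embeddingP; split=> [] []. Qed.

Definition emb_empty d (P : finPOrderType d) : embedding 'I_0 P :=
  Embedding (emb_empty_subproof P).

Record amalgamation d d1 d2 (P : finPOrderType d) (Q : finPOrderType d1)
    (P' : finPOrderType d2) (a : embedding P Q) (b : embedding P P') :=
  Amalgamation {
    am_disp : Order.disp_t;
    am_poset : finPOrderType am_disp;
    am_a : embedding P' am_poset;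
    am_b : embedding Q am_poset;
    am_comm : emb_comp am_b a = emb_comp am_a b;
    am_cover : forall z : am_poset, z \in codom am_a \/ z \in codom am_b
  }.

Definition amalgamation_iso d d1 d2 (P : finPOrderType d)
    (Q : finPOrderType d1) (P' : finPOrderType d2) (a : embedding P Q)
    (b : embedding P P') (A B : amalgamation a b) : Prop :=
  exists f : embedding (am_poset A) (am_poset B),
    [/\ bijective f,
        emb_comp f (am_a A) = am_a B &
        emb_comp f (am_b A) = am_b B].

(* The family A meets every isomorphism class of amalgamations exactly once;
   pm_amalg is imposed for every such choice of representatives. *)
Definition amalgamation_reps d d1 d2 (P : finPOrderType d)
    (Q : finPOrderType d1) (P' : finPOrderType d2) (a : embedding P Q)
    (b : embedding P P') (r : nat) (A : 'I_r -> amalgamation a b) : Prop :=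
  (forall i j, amalgamation_iso (A i) (A j) -> i = j) /\
  (forall B : amalgamation a b, exists i, amalgamation_iso (A i) B).

Record poset_measure (k : comPzRingType) := PosetMeasure {
  pm_val :> forall d1 d2 (P : finPOrderType d1) (Q : finPOrderType d2),
    embedding P Q -> k;
  pm_iso : forall d1 d2 (P : finPOrderType d1) (Q : finPOrderType d2)
    (a : embedding P Q), bijective a -> pm_val a = 1;
  pm_comp : forall d1 d2 d3 (P : finPOrderType d1) (Q : finPOrderType d2)
    (S : finPOrderType d3) (b : embedding Q S) (a : embedding P Q),
    pm_val (emb_comp b a) = pm_val b * pm_val a;
  pm_amalg : forall d d1 d2 (P : finPOrderType d) (Q : finPOrderType d1)
    (P' : finPOrderType d2) (a : embedding P Q) (b : embedding P P')
    (r : nat) (A : 'I_r -> amalgamation a b), amalgamation_reps A ->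
    pm_val a = \sum_(i < r) pm_val (am_a (A i))
}.

Definition pm_poset (k : comPzRingType) (nu : poset_measure k)
    d (P : finPOrderType d) : k := nu _ _ _ _ (emb_empty P).

Definition regular (k : fieldType) (nu : poset_measure k) : Prop :=
  forall d (P : finPOrderType d), pm_poset nu P <> 0.

(* Main.v *)
Require Import Defs.
From HB Require Import structures.
From mathcomp Require Import all_boot all_order all_algebra.

(** Why no regular measure exists.  Think of a regular measure as assigning a
size to the set of ways of adding one point to a given poset: then [nu f]
depends only on the source and the target of [f], being the quotient of their
two values ([pm_poset_emb]).  Let [c] be the value of an embedding of a point
into a 2-chain.

A point placed below the least element of a poset lies below everything, so
such points have size [c] whatever lies above the least element
([pm_below_bottom], an amalgamation problem with only one solution).  As
intermediate embeddings do not matter, any embedding of the 2-chain into the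
3-chain has value [c], and so has any embedding of the fork [p < q, y] (with
[q] and [y] incomparable) into the fork on a stem, [p < z < q, y].

Now count the points [z] lying between [p] and [q] in the presence of a point
[y] above [p] and incomparable to [q].  There are [c] of them in total, because
[p < z < q] is a 3-chain.  On the other hand [z] is either below [y], and such
points already have size [c] because [z] is then the least element of a fork
with [p] under it, or incomparable to [y] ([pm_middle_tine]).  So the latter
case has size zero, and the poset with bottom [p] and with [z < q] and [y] side
by side above it has value zero, against regularity. *)

Set Implicit Arguments.
Unset Strict Implicit.
Unset Printing Implicit Defensive.

Import Order.TTheory GRing.Theory.

Local Open Scope ring_scope.

(** * Embeddings *)

Section Embeddings.
Variables (d1 d2 : Order.disp_t) (P : finPOrderType d1) (Q : finPOrderType d2).
Implicit Type f : embedding P Q.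

Lemma emb_le f x y : (f x <= f y)%O = (x <= y)%O.
Proof. by case/is_embeddingP: (emb_funP f) => _ fP; apply/idP/idP => /fP. Qed.

Lemma emb_eq (f g : embedding P Q) : f =1 g -> f = g.
Proof. by move=> fg; apply/val_inj/ffunP. Qed.

Lemma is_embedding_le (f : P -> Q) :
  (forall x y, (f x <= f y)%O = (x <= y)%O) -> is_embedding (finfun f).
Proof.
move=> fP; apply/is_embeddingP; split=> x y; rewrite !ffunE ?fP //.
by move=> fxy; apply/le_anti; rewrite -!fP fxy lexx.
Qed.

Definition mk_emb (f : P -> Q)
    (fP : forall x y, (f x <= f y)%O = (x <= y)%O) : embedding P Q :=
  Embedding (is_embedding_le fP).

Lemma mk_embE (f : P -> Q) fP x : @mk_emb f fP x = f x.
Proof. exact: ffunE. Qed.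

End Embeddings.

(** With [nu P] invertible this determines [nu f] from its source and target,
which is how regularity enters the proof. *)
Lemma pm_poset_emb (k : comPzRingType) (nu : poset_measure k) d1 d2
    (P : finPOrderType d1) (Q : finPOrderType d2) (f : embedding P Q) :
  pm_poset nu Q = nu _ _ _ _ f * pm_poset nu P.
Proof.
rewrite /pm_poset -pm_comp; congr (nu _ _ _ _ _).
by apply: emb_eq; case.
Qed.

(** * Comparing amalgamations *)

Section Amalgamations.
Variables (d d1 d2 : Order.disp_t) (P : finPOrderType d).
Variables (Q : finPOrderType d1) (P' : finPOrderType d2).
Variables (a : embedding P Q) (b : embedding P P').
Implicit Types A B : amalgamation a b.

Lemma am_commE A p : am_b A (a p) = am_a A (b p).
Proof.
by have /(congr1 (fun f : embedding _ _ => f p)) := am_comm A; rewrite !ffunE.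
Qed.

(** An amalgamation is the quotient of the disjoint union [Q + P'] by the
equivalence of a preorder: comparing amalgamations is comparing these preorders
on one and the same type. *)
Definition am_pt A (s : Q + P') : am_poset A :=
  match s with inl x => am_b A x | inr y => am_a A y end.

Lemma am_pt_surj A z : z \in codom (am_pt A).
Proof.
case: (am_cover z) => /codomP[x ->].
  exact: (codom_f _ (inr x)).
exact: (codom_f _ (inl x)).
Qed.

(** [iinv] picks an arbitrary preimage; [am_transportE] shows that the choice
does not matter once the preorders induced on [Q + P'] agree. *)
Definition am_transport A B (z : am_poset A) : am_poset B :=
  am_pt B (iinv (am_pt_surj z)).

Lemma am_transportE A B :
    (forall s t, (am_pt A s <= am_pt A t)%O = (am_pt B s <= am_pt B t)%O) ->
  forall s, am_transport B (am_pt A s) = am_pt B s.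
Proof. by move=> AB s; apply/le_anti; rewrite -!AB f_iinv lexx. Qed.

Lemma am_pt_iso A B :
    (forall s t, (am_pt A s <= am_pt A t)%O = (am_pt B s <= am_pt B t)%O) ->
  amalgamation_iso A B.
Proof.
move=> AB; have tE := am_transportE AB.
have tE' := am_transportE (fun s t => esym (AB s t)).
have tP (x y : am_poset A) :
    (am_transport B x <= am_transport B y)%O = (x <= y)%O.
  by have /codomP[s ->] := am_pt_surj x; have /codomP[t ->] := am_pt_surj y;
     rewrite !tE AB.
exists (mk_emb tP); split.
- by exists (am_transport A) => x; have /codomP[s ->] := am_pt_surj x;
     rewrite mk_embE !(tE, tE').
- by apply: emb_eq => y; rewrite ffunE mk_embE; apply: (tE (inr y)).
- by apply: emb_eq => x; rewrite ffunE mk_embE; apply: (tE (inl x)).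
Qed.

(** Inside [Q] and inside [P'] the order is prescribed, and a point of [P] lies
in both; so only pairs of a point new in [Q] and a point new in [P'] can tell
two amalgamations apart. *)
Lemma amalgamation_iso_new A B :
    (forall x y, x \notin codom a -> y \notin codom b ->
       (am_b A x <= am_a A y)%O = (am_b B x <= am_a B y)%O) ->
    (forall x y, x \notin codom a -> y \notin codom b ->
       (am_a A y <= am_b A x)%O = (am_a B y <= am_b B x)%O) ->
  amalgamation_iso A B.
Proof.
move=> le_ba le_ab; apply: am_pt_iso => -[x|y] [x'|y'] /=; rewrite ?emb_le //.
- have [/codomP[p ->]|xa] := boolP (x \in codom a).
    by rewrite !am_commE !emb_le.
  have [/codomP[p ->]|yb] := boolP (y' \in codom b); last exact: le_ba.
  by rewrite -!am_commE !emb_le.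
- have [/codomP[p ->]|xa] := boolP (x' \in codom a).
    by rewrite !am_commE !emb_le.
  have [/codomP[p ->]|yb] := boolP (y \in codom b); last exact: le_ab.
  by rewrite -!am_commE !emb_le.
Qed.

Lemma amalgamation_iso_le A B : amalgamation_iso A B ->
  forall x y, (am_b A x <= am_a A y)%O = (am_b B x <= am_a B y)%O.
Proof. by move=> [f [_ <- <-]] x y; rewrite !ffunE emb_le. Qed.

Lemma pm_unique_amalgamation (k : comPzRingType) (nu : poset_measure k) A :
  (forall B, amalgamation_iso A B) -> nu _ _ _ _ a = nu _ _ _ _ (am_a A).
Proof.
move=> AP; rewrite (@pm_amalg _ nu _ _ _ _ _ _ a b 1 (fun=> A)) ?big_ord1 //.
by split=> [i j _|B]; [rewrite !ord1 | exists ord0].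
Qed.

Lemma pm_two_amalgamations (k : comPzRingType) (nu : poset_measure k) A1 A2 :
    ~ amalgamation_iso A1 A2 -> ~ amalgamation_iso A2 A1 ->
    (forall B, amalgamation_iso A1 B \/ amalgamation_iso A2 B) ->
  nu _ _ _ _ a = nu _ _ _ _ (am_a A1) + nu _ _ _ _ (am_a A2).
Proof.
move=> n12 n21 AP; pose A (i : 'I_2) := if val i == 0%N then A1 else A2.
rewrite (@pm_amalg _ nu _ _ _ _ _ _ a b 2 A) ?big_ord_recl ?big_ord0 ?addr0 //.
split=> [|B]; last first.
  by case: (AP B) => ?; [exists ord0 | exists ord_max].
by case=> [[|[|//]] ?] [[|[|//]] ?]; rewrite /A //= => ?; apply: val_inj.
Qed.

End Amalgamations.

(** * Adding one point to a poset *)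

(** The new point [None] lies below all of [S] if [b] holds, and is incomparable
to all of [S] otherwise.  All posets below are built from ['I_1] in this way.  The
operation is functorial ([ext_map]), which provides their embeddings. *)
Definition ext (b : bool) (S : Type) := option S.

Section ExtOrder.
Variables (d : Order.disp_t) (b : bool) (S : finPOrderType d).

HB.instance Definition _ := Finite.on (ext b S).

Definition ext_le (x y : ext b S) : bool :=
  match x, y with
  | None, None => true
  | None, Some _ => b
  | Some _, None => false
  | Some x, Some y => (x <= y)%O
  end.

Lemma ext_le_refl : reflexive ext_le.
Proof. by case=> /=. Qed.

Lemma ext_le_anti : antisymmetric ext_le.
Proof.
by case=> [x|] [y|] //=; [move/le_anti-> | rewrite andbF].
Qed.

Lemma ext_le_trans : transitive ext_le.
Proof. by case=> [y|] [x|] [z|] //=; apply: le_trans. Qed.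

HB.instance Definition _ := Order.Le_isPOrder.Build d (ext b S)
  ext_le_refl ext_le_anti ext_le_trans.

Lemma ext_leE (x y : ext b S) : (x <= y)%O = ext_le x y.
Proof. by []. Qed.

Fact ext_in_le (x y : S) : ((Some x : ext b S) <= Some y)%O = (x <= y)%O.
Proof. by []. Qed.

Definition ext_in : embedding S (ext b S) := mk_emb ext_in_le.

End ExtOrder.

Section ExtMap.
Variables (d1 d2 : Order.disp_t) (b : bool).
Variables (S : finPOrderType d1) (T : finPOrderType d2) (f : embedding S T).

Fact ext_map_le (x y : ext b S) :
  ((omap f x : ext b T) <= omap f y)%O = (x <= y)%O.
Proof. by case: x y => [x|] [y|] //; rewrite !ext_leE /= emb_le. Qed.

Definition ext_map : embedding (ext b S) (ext b T) := mk_emb ext_map_le.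
End ExtMap.

Notation bot := (ext true).
Notation par := (ext false).

(** * Points below a least element *)

Section BelowBottom.
Variables (d : Order.disp_t) (T : finPOrderType d).

Fact bottom_le (x y : 'I_1) : ((None : bot T) <= None)%O = (x <= y)%O.
Proof. by rewrite !ord1. Qed.
Definition bottom : embedding 'I_1 (bot T) := mk_emb bottom_le.

Fact below_bottom_comm :
  emb_comp (ext_map true bottom) (ext_in true 'I_1) =
  emb_comp (ext_in true (bot T)) bottom.
Proof. by apply: emb_eq => x; rewrite !ffunE /= !ffunE. Qed.

Fact below_bottom_cover (z : bot (bot T)) :
  z \in codom (ext_in true (bot T)) \/ z \in codom (ext_map true bottom).
Proof.
case: z => [z|]; [left|right]; apply/codomP.
  by exists z; rewrite ffunE.
by exists None; rewrite ffunE.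
Qed.

Definition below_bottom : amalgamation (ext_in true 'I_1) bottom :=
  Amalgamation below_bottom_comm below_bottom_cover.

(** In any amalgamation the added point lies strictly below the glued point,
which is the least element of [bot T]; hence it lies strictly below everything. *)
Lemma below_bottom_unique B : amalgamation_iso below_bottom B.
Proof.
have E : bottom ord0 = None by rewrite ffunE.
have C := am_commE B ord0; rewrite E ffunE in C.
apply: amalgamation_iso_new => [[x|] y /negP xa _|[x|] y /negP xa _].
- by case: xa; apply/codomP; exists x; rewrite ffunE.
- transitivity true; first by rewrite !ffunE.
  apply/esym/(@le_trans _ _ (am_b B (Some ord0))); first by rewrite emb_le.
  by rewrite C emb_le; case: y.
- by case: xa; apply/codomP; exists x; rewrite ffunE.
- transitivity false; first by rewrite !ffunE.
  apply/esym/negP=> yx; have: (am_b B (Some ord0) <= am_b B None)%O.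
    by apply: le_trans yx; rewrite C emb_le; case: y.
  by rewrite emb_le.
Qed.

Lemma pm_below_bottom (k : comPzRingType) (nu : poset_measure k) :
  nu _ _ _ _ (ext_in true (bot T)) = nu _ _ _ _ (ext_in true 'I_1).
Proof. by rewrite (pm_unique_amalgamation nu below_bottom_unique). Qed.

End BelowBottom.

(** * Points in the middle of a chain, seen from a fork *)

(** The chain [p < q] is [bot 'I_1].  It is completed to [p < z < q] by [middle]
and to the fork [p < q, y] by [tine]; both new points are [Some None].  The two
amalgamations extend the fork by [z], either as a stem carrying both tines
([stem]) or on the tine [q] only ([notch]).  In both, the chain [p < z < q] is
embedded so as to avoid [y] ([stem_chain], [notch_chain]). *)
Definition middle : embedding (bot 'I_1) (bot (bot 'I_1)) :=
  ext_map true (ext_in true 'I_1).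
Definition tine : embedding (bot 'I_1) (bot (par 'I_1)) :=
  ext_map true (ext_in false 'I_1).

Definition stem : embedding (bot (par 'I_1)) (bot (bot (par 'I_1))) :=
  ext_map true (ext_in true (par 'I_1)).
Definition notch : embedding (bot (par 'I_1)) (bot (par (bot 'I_1))) :=
  ext_map true (ext_map false (ext_in true 'I_1)).

Definition stem_chain : embedding (bot (bot 'I_1)) (bot (bot (par 'I_1))) :=
  ext_map true (ext_map true (ext_in false 'I_1)).
Definition notch_chain : embedding (bot (bot 'I_1)) (bot (par (bot 'I_1))) :=
  ext_map true (ext_in false (bot 'I_1)).

Fact am_stem_comm : emb_comp stem_chain middle = emb_comp stem tine.
Proof. by apply: emb_eq => -[x|]; rewrite !ffunE //= !ffunE /= !ffunE. Qed.

Fact am_stem_cover (z : bot (bot (par 'I_1))) :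
  z \in codom stem \/ z \in codom stem_chain.
Proof.
case: z => [[z|]|]; [left|right|left]; apply/codomP.
- by exists (Some z); rewrite ffunE /= ffunE.
- by exists (Some None); rewrite ffunE /= ffunE.
- by exists None; rewrite ffunE.
Qed.

Definition am_stem : amalgamation middle tine :=
  Amalgamation am_stem_comm am_stem_cover.

Fact am_notch_comm : emb_comp notch_chain middle = emb_comp notch tine.
Proof. by apply: emb_eq => -[x|]; rewrite !ffunE //= !ffunE /= !ffunE. Qed.

Fact am_notch_cover (z : bot (par (bot 'I_1))) :
  z \in codom notch \/ z \in codom notch_chain.
Proof.
case: z => [[z|]|]; [right|left|left]; apply/codomP.
- by exists (Some z); rewrite ffunE /= ffunE.
- by exists (Some None); rewrite ffunE /= ffunE.
- by exists None; rewrite ffunE.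
Qed.

Definition am_notch : amalgamation middle tine :=
  Amalgamation am_notch_comm am_notch_cover.

Lemma am_stem_le : (am_b am_stem (Some None) <= am_a am_stem (Some None))%O.
Proof. by rewrite !ffunE /= !ffunE. Qed.

Lemma am_notch_le :
  (am_b am_notch (Some None) <= am_a am_notch (Some None))%O = false.
Proof. by rewrite !ffunE /= !ffunE. Qed.

Lemma middle_new x : x \notin codom middle -> x = Some None.
Proof.
case: x => [[t|]|] // /negP[]; apply/codomP.
  by exists (Some t); rewrite ffunE /= ffunE.
by exists None; rewrite ffunE.
Qed.

Lemma tine_new y : y \notin codom tine -> y = Some None.
Proof.
case: y => [[t|]|] // /negP[]; apply/codomP.
  by exists (Some t); rewrite ffunE /= ffunE.
by exists None; rewrite ffunE.
Qed.

(** If [y <= z] then [y <= z <= q], but [y] and [q] are incomparable. *)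
Lemma am_middle_tine_ge (B : amalgamation middle tine) :
  (am_a B (Some None) <= am_b B (Some None))%O = false.
Proof.
apply/negP=> yz; have C := am_commE B (Some ord0).
rewrite !ffunE /= !ffunE in C.
have: (am_a B (Some None) <= am_a B (Some (Some ord0)))%O.
  by apply: le_trans yz _; rewrite -C emb_le.
by rewrite emb_le.
Qed.

Lemma am_middle_tine_iso (A B : amalgamation middle tine) :
  (am_b A (Some None) <= am_a A (Some None))%O =
  (am_b B (Some None) <= am_a B (Some None))%O -> amalgamation_iso A B.
Proof.
by move=> AB; apply: amalgamation_iso_new => x y /middle_new-> /tine_new->;
   rewrite ?am_middle_tine_ge.
Qed.

Lemma pm_middle_tine (k : comPzRingType) (nu : poset_measure k) :
  nu _ _ _ _ middle = nu _ _ _ _ stem + nu _ _ _ _ notch.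
Proof.
apply: (@pm_two_amalgamations _ _ _ _ _ _ _ _ k nu am_stem am_notch).
- by move/amalgamation_iso_le/(_ (Some None) (Some None));
     rewrite am_stem_le am_notch_le.
- by move/amalgamation_iso_le/(_ (Some None) (Some None));
     rewrite am_stem_le am_notch_le.
move=> B; have [zy|zy] := boolP (am_b B (Some None) <= am_a B (Some None))%O.
  by left; apply: am_middle_tine_iso; rewrite am_stem_le zy.
by right; apply: am_middle_tine_iso; rewrite am_notch_le (negPf zy).
Qed.

Theorem proposition8p2 (k : fieldType) (nu : poset_measure k) : ~ regular nu.
Proof.
move=> reg.
have val_eq d1 d2 (P : finPOrderType d1) (Q : finPOrderType d2)
    (f g : embedding P Q) : nu _ _ _ _ f = nu _ _ _ _ g.
  by have/eqP P0 := reg _ P; apply: (mulIf P0); rewrite -!pm_poset_emb.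
(* Both [middle] and [stem] may be traded for the embedding that adds a point at
   the bottom, whose value is known. *)
have := pm_middle_tine nu.
rewrite (val_eq _ _ _ _ _ (ext_in true _)) pm_below_bottom.
rewrite (val_eq _ _ _ _ stem (ext_in true _)) pm_below_bottom.
rewrite -[LHS]addr0 => /addrI N0; apply: (reg _ (bot (par (bot 'I_1)))).
by rewrite (pm_poset_emb nu notch) -N0 mul0r.
Qed.
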